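(* Let $n\ge 2$ and let $\lambda=(\lambda_1,\dots,\lambda_n)$ be a strictly dominant weight of $GL_n$ (integers with $\lambda_1>\cdots>\lambda_n$) such that $\lambda_1+\cdots+\lambda_n=0$. Consider the string space $\mathbb{R}^d=\mathbb{R}^{n-1}\oplus\mathbb{R}^{n-2}\oplus\cdots\oplus\mathbb{R}^1$, $d=\frac{n(n-1)}{2}$, with functions $l_i(x)=\sigma_{i-1}(x)+\sigma_{i+1}(x)$ for $i=1,\dots,n-1$, where $\sigma_0=\sigma_n=0$. Then the Gelfand--Zetlin polytope $Q_\lambda$ coincides with the polytope $$\big[(D_1)(D_2D_1)(D_3D_2D_1)\cdots(D_{n-1}\cdots D_1)\big](a_\lambda),$$ where $a_\lambda\in\mathbb{R}^d$ is the point $(\lambda_2,\dots,\lambda_n;\lambda_3,\dots,\lambda_n;\dots;\lambda_n)$.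
   Context: **Coordinates.** The $i$-th summand of $\mathbb{R}^d$ is $\mathbb{R}^{d_i}$ with $d_i=n-i$ and coordinates $x^i_1,\dots,x^i_{n-i}$, $i=1,\dots,n-1$; points are written $(x^1_1,\dots,x^1_{n-1};\dots;x^{n-1}_1)$. Put $\sigma_i(x)=\sum_{k=1}^{d_i}x^i_k$. (The linear function $l_i$ vanishes on $\mathbb{R}^{d_i}$, as required for a string space.) **Gelfand--Zetlin polytope.** With $x^0_j:=\lambda_j$ for $j=1,\dots,n$, $Q_\lambda\subset\mathbb{R}^d$ is defined by the inequalities $x^{i-1}_j\ge x^i_j\ge x^{i-1}_{j+1}$ for all $1\le i\le n-1$, $1\le j\le n-i$. **Parapolytopes.** For $\mu,\nu\in\mathbb{R}^{d_i}$ with $\mu_k\le\nu_k$, $\Pi(\mu,\nu)=\{x\in\mathbb{R}^{d_i}:\mu_k\le x^i_k\le\nu_k,\ k=1,\dots,d_i\}$. A convex polytope $P\subset\mathbb{R}^d$ is a parapolytope if for every $i$ and every $c\in\mathbb{R}^d$ the intersection $P\cap(c+\mathbb{R}^{d_i})$, if nonempty, equals $c+\Pi(\mu_c,\nu_c)$ for some $\mu_c,\nu_c$. $\mathbb{I}_P$ is the characteristic function of $P$; a polytope is identified with its characteristic function, and a point with the one-point polytope. **Operator $D_i$.** Let $P$ be a parapolytope, and let $j\in\{1,\dots,d_i\}$ be the smallest index such that $P$ lies in a hyperplane $\{x^i_j=\mathrm{const}\}$; if no such $j$ exists, $D_i(\mathbb{I}_P)$ is not defined. With this $j$ (chosen for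 the whole of $P$), $D_i(\mathbb{I}_P)$ is the function defined on each $c+\mathbb{R}^{d_i}$, $c\in\bigoplus_{k\ne i}\mathbb{R}^{d_k}$, as follows. If $P\cap(c+\mathbb{R}^{d_i})=\emptyset$, it is $0$ there. Otherwise write $P_c:=P\cap(c+\mathbb{R}^{d_i})=c+\Pi(\mu,\nu)$ (so $\mu_j=\nu_j$), and define $\nu'$ by $\nu'_k=\nu_k$ for $k\ne j$ and $\sum_{k=1}^{d_i}(\mu_k+\nu'_k)=l_i(c)$. - If $\nu'_j\ge\nu_j$, the restriction to $c+\mathbb{R}^{d_i}$ is the characteristic function of $c+\Pi(\mu,\nu')$. - If $\nu'_j<\nu_j$, let $\mu'_k=\mu_k$ for $k\ne j$, $\mu'_j=\nu'_j$, $D^-=c+\Pi(\mu',\nu)$, and $P'_c=D^-\cap\{x^i_j=\nu'_j\}$. The restriction to $c+\mathbb{R}^{d_i}$ is $-\mathbb{I}_{D^-}+\mathbb{I}_{P_c}+\mathbb{I}_{P'_c}$. When $D_i(\mathbb{I}_P)$ is the characteristic function of a polytope, that polytope is denoted $D_i(P)$. **Composition.** Products of operators are compositions, the rightmost operator being applied first; thus $(D_{n-1}\cdots D_1)$ means that $D_1$ is applied first, then $D_2$, and so on up to $D_{n-1}$. *)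

(* Defs.v *)
From HB Require Import structures.
From mathcomp Require Export all_boot all_order all_algebra.
From mathcomp Require Export boolp classical_sets reals numfun.
Set Implicit Arguments.
Unset Strict Implicit.
Unset Printing Implicit Defensive.
Import Order.TTheory GRing.Theory Num.Theory.
Local Open Scope classical_set_scope.
Local Open Scope ring_scope.

(* All indices start at 0: the block i : 'I_r and the coordinate k : 'I_(d i)
   stand for the (i+1)-th summand and its (k+1)-th coordinate. *)

Section StringSpace.
Variables (R : realType) (r : nat) (d : 'I_r -> nat).

Definition string_space := 'rV[R]_(\sum_(i < r) d i).
Implicit Types (P Q : set string_space) (c x : string_space) (i : 'I_r).

Definition block x i : 'rV[R]_(d i) := submxrow x i.
Definition coord x i (k : 'I_(d i)) : R := block x i 0 k.

(* the affine subspace c + R^(d i) *)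
Definition fiber i c : set string_space :=
  [set x | forall k, k != i -> block x k = block c k].

Definition slice P i c : set string_space := P `&` fiber i c.

(* c + Pi(mu, nu), where c is understood modulo R^(d i): mu and nu bound the
   coordinates of the i-th block themselves, not their offsets from c. *)
Definition box i c (mu nu : 'rV[R]_(d i)) : set string_space :=
  fiber i c `&` [set x | forall k, mu 0 k <= coord x k <= nu 0 k].

(* bounded solution set of finitely many affine inequalities *)
Definition convex_polytope P : Prop :=
  (exists m (A : 'M[R]_(\sum_(i < r) d i, m)) (b : 'rV[R]_m),
     P = [set x | forall k, (x *m A) 0 k <= b 0 k]) /\
  (exists M : R, forall x, P x -> forall k, `|x 0 k| <= M).

Definition parapolytope P : Prop :=
  convex_polytope P /\
  forall i c, slice P i c !=set0 ->
    exists mu nu : 'rV[R]_(d i),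
      (forall k, mu 0 k <= nu 0 k) /\ slice P i c = box c mu nu.

Definition in_hyperplane P i (j : 'I_(d i)) : Prop :=
  exists a : R, forall x, P x -> coord x j = a.

Definition first_constant P i (j : 'I_(d i)) : Prop :=
  in_hyperplane P j /\ forall k : 'I_(d i), (k < j)%N -> ~ in_hyperplane P k.

Definition set_coord i (v : 'rV[R]_(d i)) (j : 'I_(d i)) (t : R) :
    'rV[R]_(d i) :=
  \row_k (if k == j then t else v 0 k).

Variable l : 'I_r -> string_space -> R.

(* The function that replaces, on the fiber through c, the characteristic
   function of box c mu nu; here t is the solution nu'_j of
   \sum_k (mu_k + nu'_k) = l i c with nu'_k = nu_k for k != j. *)
Definition divdiff_box i (j : 'I_(d i)) c (mu nu : 'rV[R]_(d i)) :
    string_space -> R :=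
  let t := l i c - (\sum_k mu 0 k + \sum_(k | k != j) nu 0 k) in
  if nu 0 j <= t then \1_(box c mu (set_coord nu j t))
  else
    let Dminus := box c (set_coord mu j t) nu in
    fun x => - \1_Dminus x + \1_(box c mu nu) x
             + \1_(Dminus `&` [set y | coord y j = t]) x.

(* f = D_i(1_P); in particular D_i(1_P) is defined. Since l i is meant not to
   depend on the i-th block, c may range over all points rather than over the
   points with zero i-th block. *)
Definition is_divdiff i P (f : string_space -> R) : Prop :=
  parapolytope P /\
  exists2 j : 'I_(d i), first_constant P j &
    forall c,
      (slice P i c = set0 -> forall x, fiber i c x -> f x = 0) /\
      (forall mu nu : 'rV[R]_(d i), (forall k, mu 0 k <= nu 0 k) ->
         slice P i c = box c mu nu ->
         forall x, fiber i c x -> f x = divdiff_box j c mu nu x).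

Lemma first_constant_uniq P i (j k : 'I_(d i)) :
  first_constant P j -> first_constant P k -> j = k.
Proof.
move=> [hj nj] [hk nk]; apply/val_inj => /=.
by case: (ltngtP j k) => // [/nk|/nj].
Qed.

Lemma is_divdiff_uniq i P f g :
  is_divdiff i P f -> is_divdiff i P g -> f = g.
Proof.
move=> [[_ paraP] [j jP fP]] [_ [k kP gP]].
have {}gP : forall c,
    (slice P i c = set0 -> forall x, fiber i c x -> g x = 0) /\
    (forall mu nu : 'rV[R]_(d i), (forall k, mu 0 k <= nu 0 k) ->
       slice P i c = box c mu nu ->
       forall x, fiber i c x -> g x = divdiff_box j c mu nu x).
  by rewrite (first_constant_uniq jP kP).
apply/funext => x; have xx : fiber i x x by [].
have [[f0 fb] [g0 gb]] := (fP x, gP x).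
have [P0|/set0P /paraP[mu [nu [le_mn Pbox]]]] := eqVneq (slice P i x) set0.
  by rewrite f0 // g0.
by rewrite (fb _ _ le_mn Pbox) // (gb _ _ le_mn Pbox).
Qed.

(* The polytope D_i(P), or None if D_i(1_P) is undefined or is not the
   characteristic function of a polytope. *)
Definition divdiff i P : option (set string_space) :=
  if pselect (exists Q, convex_polytope Q /\ is_divdiff i P \1_Q) is left h
  then Some (projT1 (cid h)) else None.

Lemma divdiffE i P Q :
  divdiff i P = Some Q <-> convex_polytope Q /\ is_divdiff i P \1_Q.
Proof.
rewrite /divdiff; case: pselect => [h|nh]; last first.
  by split=> // hQ; case: nh; exists Q.
case: (cid h) => Q' /= hQ'; split=> [[<-] //|[_ hQ]].
congr Some; case: hQ' => _ /is_divdiff_uniq/(_ hQ) QQ'.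
apply/funext => x; apply/propext.
have /eqP := congr1 (@^~ x) QQ'; rewrite /= !indicE eqr_nat => /eqP xQ.
by split=> /mem_set xA; apply/set_mem; move: xQ; rewrite xA; case: (_ \in _).
Qed.

(* The value at P of the product of the D_i, i in s, the last operator of s
   being applied first. *)
Definition divdiff_prod (s : seq 'I_r) P : option (set string_space) :=
  foldr (fun i => obind (divdiff i)) (Some P) s.

End StringSpace.

Section GelfandZetlin.
Variables (R : realType) (n : nat).

Definition gz_dim (i : 'I_n.-1) : nat := n - i.+1.

Local Notation V := (string_space R gz_dim).

(* sigma m is the sum of the coordinates of the m-th summand in the numbering
   1, ..., n - 1, and hence is 0 for m = 0 and m = n. *)
Definition sigma (m : nat) (x : V) : R :=
  \sum_(i < n.-1 | i.+1 == m) \sum_(k < gz_dim i) coord x k.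

Definition gz_l (i : 'I_n.-1) (x : V) : R := sigma i x + sigma i.+2 x.

Variable lam : n.-tuple int.

(* Row 0 is lam and row i.+1 is the block i of x; outside the triangular array
   the entry is 0, a value that gz_polytope does not use. *)
Definition gz_entry (x : V) (i j : nat) : R :=
  if i is i'.+1 then
    if (insub i' : option 'I_n.-1) is Some i0 then
      if (insub j : option 'I_(gz_dim i0)) is Some j0 then coord x j0 else 0
    else 0
  else (lam`_j)%:~R.

Definition gz_polytope : set V :=
  [set x | forall (i : 'I_n.-1) (j : 'I_(gz_dim i)),
     gz_entry x i j.+1 <= gz_entry x i.+1 j <= gz_entry x i j].

Definition gz_point : V :=
  \mxrow_(i < n.-1) \row_(k < gz_dim i) (lam`_(i.+1 + k))%:~R.

End GelfandZetlin.

(* The word (D_1)(D_2 D_1) ... (D_(n-1) ... D_1), as written from left to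
   right. *)
Definition gz_word (n : nat) : seq 'I_n.-1 :=
  flatten [seq rev [seq i : 'I_n.-1 <- enum 'I_n.-1 | (i <= m)%N]
          | m : 'I_n.-1 <- enum 'I_n.-1].

(* Main.v *)
Require Import Defs.
From mathcomp Require Import zify ring lra.
Import Order.TTheory GRing.Theory Num.Theory.
Local Open Scope classical_set_scope.
Local Open Scope ring_scope.

(** The polytopes met on the way are faces of Q_lambda of a special kind: some
    coordinates are free, and each other x^a_b is frozen at lambda_(a+b), the
    value that it has at the vertex a_lambda.  At the start everything is
    frozen.  The factor (D_m ... D_1) applied as the p-th one frees column p
    from the top down: D_i frees x^i_p.  After the last factor everything is
    free, and the face is all of Q_lambda.

    Each inequality of Q_lambda compares entries in adjacent rows, so it
    involves at most one coordinate of a given row.  Hence the slice of a face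
    along row i is a box ([slice_face]): x^i_k runs over the interval
      [max(x^(i-1)_(k+1), x^(i+1)_k), min(x^(i-1)_k, x^(i+1)_(k-1))]
    if it is free, where a missing neighbour is left out, and is constant
    otherwise.

    That D_i computes the right upper bound rests on one identity.  In the sum
    of all lower and upper bounds of row i, the maximum that bounds x^i_k below
    and the minimum that bounds x^i_(k+1) above are taken over the same two
    entries x^(i-1)_(k+1), x^(i+1)_k, so together they contribute the sum of
    these entries.  The whole sum telescopes to sigma_(i-1) + sigma_(i+1), which
    is l_i ([sum_lower_upper]); in the first row this uses that lambda sums to
    0 = sigma_0.  Moreover, on the faces met when D_i frees x^i_p, the
    bounds of the coordinates of row i in the columns >= p agree with their
    frozen values, except for the upper bound of x^i_p ([lower_tail],
    [upper_tail]).  So the equation that defines nu'_p in D_i has as its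
    solution precisely this upper bound, which is at least the frozen value, and
    D_i replaces the box of the old face by that of the face in which x^i_p is
    free ([is_divdiff_face]).  Strict dominance ensures that column p is the
    first one in which row i is constant ([face_nonconstant]).

    The indices above start at 1, and row 0 is lambda.  In the code, blocks and
    columns are numbered from 0, so block [i] is row [i.+1]. *)

Set Implicit Arguments.
Unset Strict Implicit.
Unset Printing Implicit Defensive.

(** * Finite systems of affine inequalities *)

Section Polyhedra.
Variables (R : realType) (N : nat).
Implicit Types (P Q : set 'rV[R]_N) (f g : 'rV[R]_N -> R).

Definition affine_form f : Prop :=
  exists (a : 'cV[R]_N) (c : R), forall x, f x = (x *m a) 0 0 + c.

(** Lists of inequalities, rather than a matrix, make intersections a
    concatenation. *)
Definition polyhedron P : Prop :=
  exists s : seq ('cV[R]_N * R),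
    forall x, P x <-> all (fun h => (x *m h.1) 0 0 <= h.2) s.

Lemma affine_form_cst (c : R) : affine_form (fun=> c).
Proof. by exists 0, c => x; rewrite mulmx0 mxE add0r. Qed.

Lemma affine_form_entry (k : 'I_N) : affine_form (fun x => x 0 k).
Proof.
by exists (delta_mx k 0), 0 => x; rewrite -colE mxE addr0.
Qed.

Lemma polyhedron_ext P Q :
  (forall x, P x <-> Q x) -> polyhedron P -> polyhedron Q.
Proof. by move=> PQ [s sP]; exists s => x; rewrite -PQ. Qed.

Lemma polyhedron_le f g :
  affine_form f -> affine_form g -> polyhedron [set x | f x <= g x].
Proof.
move=> [a [c fE]] [a' [c' gE]]; exists [:: (a - a', c' - c)] => x /=.
rewrite fE gE andbT mulmxBr !mxE.
by split; lra.
Qed.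

Lemma polyhedronI P Q : polyhedron P -> polyhedron Q -> polyhedron (P `&` Q).
Proof.
move=> [s sP] [t tQ]; exists (s ++ t) => x; rewrite all_cat /=.
by split=> [[/sP -> /tQ ->] //|/andP[/sP + /tQ]].
Qed.

Lemma polyhedron_forall (T : finType) (P : T -> set 'rV[R]_N) :
  (forall t, polyhedron (P t)) -> polyhedron [set x | forall t, P t x].
Proof.
move=> /choice[s sP]; exists (flatten [seq s t | t <- enum T]) => x.
split=> [Px|/allP Px t].
  by apply/allP => h /flatten_mapP[t _]; have /allP := (sP t x).1 (Px t); apply.
apply/sP/allP => h ht; apply: Px; apply/flatten_mapP.
by exists t; rewrite ?mem_enum.
Qed.

Lemma polyhedron_imply (b : bool) P :
  polyhedron P -> polyhedron [set x | b -> P x].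
Proof.
case: b => PP; first by apply: polyhedron_ext PP => x /=; split=> // /(_ isT).
by exists [::].
Qed.

Lemma polyhedron_mx P : polyhedron P ->
  exists m (A : 'M[R]_(N, m)) (b : 'rV[R]_m),
    P = [set x | forall k, (x *m A) 0 k <= b 0 k].
Proof.
move=> [s sP].
pose h (k : 'I_(size s)) := tnth (in_tuple s) k.
exists (size s), (\matrix_(i, k) (h k).1 i 0), (\row_k (h k).2).
have hE x k : (x *m \matrix_(i, k) (h k).1 i 0) 0 k = (x *m (h k).1) 0 0.
  by rewrite !mxE; apply: eq_bigr => i _; rewrite mxE.
apply/seteqP; split=> x /=.
  move=> /sP/allP xs k; rewrite hE mxE; apply: xs.
  exact: (mem_tnth k (in_tuple s)).
move=> xs; apply/sP/allP => g /(tnthP (in_tuple s))[k ->].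
by have := xs k; rewrite hE mxE.
Qed.

End Polyhedra.

(** * Fibers and boxes of a string space *)

Section Boxes.
Variables (R : realType) (r : nat) (d : 'I_r -> nat).
Implicit Types (i : 'I_r) (c z : string_space R d).

Lemma coordE c i (k : 'I_(d i)) : coord c k = c 0 (tagnat.Rank i k).
Proof. by rewrite /coord /block /submxrow mxE. Qed.

Lemma coord_mxrow (v : forall i, 'rV[R]_(d i)) i (k : 'I_(d i)) :
  coord (\mxrow_i v i : string_space R d) k = v i 0 k.
Proof. by rewrite /coord /block mxrowK. Qed.

Lemma coord_inj c z :
  (forall i (k : 'I_(d i)), coord c k = coord z k) -> c = z.
Proof. by move=> cz; apply/mxrowP => i; apply/rowP => k; apply: cz. Qed.

Lemma fiber_replace i c (v : 'rV[R]_(d i)) :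
  exists2 z, fiber i c z & block z i = v.
Proof.
exists (\mxrow_k dfwith (block c) v k); last by rewrite /block mxrowK dfwith_in.
by move=> k ki; rewrite [LHS]mxrowK dfwith_out // eq_sym.
Qed.

Lemma fiber_eq i c z : fiber i c z -> fiber i c = fiber i z.
Proof.
by move=> cz; apply/seteqP; split=> x /= xz k ki; rewrite xz // cz.
Qed.

Lemma box_sub i c (mu nu mu' nu' : 'rV[R]_(d i)) :
  (forall k, mu 0 k <= nu 0 k) ->
  box c mu nu `<=` box c mu' nu' ->
  forall k, mu' 0 k <= mu 0 k /\ nu 0 k <= nu' 0 k.
Proof.
move=> le_mn sub k.
have [y cy yE] := fiber_replace c mu; have [z cz zE] := fiber_replace c nu.
have [|_ /(_ k)] := sub y.
  by split=> // k'; rewrite /= /coord yE lexx le_mn.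
rewrite /coord yE => /andP[-> _].
have [|_ /(_ k)] := sub z.
  by split=> // k'; rewrite /= /coord zE lexx le_mn.
by rewrite /coord zE => /andP[_ ->].
Qed.

(** The value of D_i is prescribed for every description of a slice as a box;
    since the bounds are determined by the box, one description suffices. *)
Lemma box_inj i c (mu nu mu' nu' : 'rV[R]_(d i)) :
  (forall k, mu 0 k <= nu 0 k) -> (forall k, mu' 0 k <= nu' 0 k) ->
  box c mu nu = box c mu' nu' -> mu = mu' /\ nu = nu'.
Proof.
move=> le_mn le_mn' eq_box.
have sub : box c mu nu `<=` box c mu' nu' by rewrite eq_box.
have sub' : box c mu' nu' `<=` box c mu nu by rewrite eq_box.
split; apply/rowP => k; apply/eqP; rewrite eq_le;
  have [le1 le2] := box_sub le_mn sub k;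
  have [le3 le4] := box_sub le_mn' sub' k; by rewrite ?le1 ?le2 ?le3 ?le4.
Qed.

Lemma box_le i c z (mu nu : 'rV[R]_(d i)) :
  box c mu nu z -> forall k, mu 0 k <= nu 0 k.
Proof. by move=> [_ bz] k; case/andP: (bz k) => /le_trans h /h. Qed.

Lemma set_coord_restore i (v : 'rV[R]_(d i)) (j : 'I_(d i)) (s : R) :
  set_coord (set_coord v j s) j (v 0 j) = v.
Proof. by apply/rowP => k; rewrite !mxE; case: eqP => [->|]. Qed.

Lemma divdiff_prod_cat (l : 'I_r -> string_space R d -> R) s1 s2 P Q :
  divdiff_prod l s2 P = Some Q ->
  divdiff_prod l (s1 ++ s2) P = divdiff_prod l s1 Q.
Proof. by rewrite /divdiff_prod foldr_cat => ->. Qed.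

End Boxes.

(** * Faces of the Gelfand-Zetlin polytope *)

Section Faces.
Variables (R : realType) (n : nat) (lam : n.-tuple int).
Hypothesis hdom : forall i j : 'I_n, (i < j)%N -> lam`_j < lam`_i.
Hypothesis hsum : \sum_(i < n) lam`_i = 0.

Local Notation V := (string_space R (@gz_dim n)).
Local Notation E := (@gz_entry R n lam).
Local Notation L b := ((lam`_b)%:~R : R).
Local Notation Q := (@gz_polytope R n lam).
Implicit Types (x y z c : V) (i : 'I_n.-1) (free : nat -> nat -> bool).

Lemma lam_lt a b : (a < b)%N -> (b < n)%N -> L b < L a.
Proof.
move=> ab bn; rewrite ltr_int.
exact: (@hdom (Ordinal (ltn_trans ab bn)) (Ordinal bn)).
Qed.

Lemma lam_le a b : (a <= b)%N -> (b < n)%N -> L b <= L a.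
Proof.
by rewrite leq_eqVlt => /predU1P[-> //|ab bn]; apply/ltW/lam_lt.
Qed.

Lemma triangle_lt i (k : 'I_(gz_dim i)) : (i.+1 + k < n)%N.
Proof. by have := ltn_ord k; rewrite /gz_dim; lia. Qed.

(** Coordinates are handled as entries of a triangular array indexed by natural
    numbers, which avoids the dependent type of a coordinate within its row. *)
Lemma triangleP (P : nat -> nat -> Prop) :
  (forall i (k : 'I_(gz_dim i)), P i k) ->
  forall a b, (a.+1 + b < n)%N -> P a b.
Proof.
move=> Pik a b ab; have an : (a < n.-1)%N by lia.
have bn : (b < gz_dim (Ordinal an))%N by rewrite /gz_dim /=; lia.
exact: (Pik (Ordinal an) (Ordinal bn)).
Qed.

Lemma gz_entryS x i (k : 'I_(gz_dim i)) : E x i.+1 k = coord x k.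
Proof. by rewrite /gz_entry !valK. Qed.

Lemma gz_polytopeP x :
  Q x <-> forall a b, (a.+1 + b < n)%N -> E x a b.+1 <= E x a.+1 b <= E x a b.
Proof.
split=> [Qx|Qx i k]; last exact/Qx/triangle_lt.
exact: triangleP.
Qed.

Lemma fiber_entry i c x a b : fiber i c x -> a != i.+1 -> E x a b = E c a b.
Proof.
move=> cx; case: a => // a ai; rewrite /gz_entry.
case: insubP => // i0 _ i0a; case: insubP => // k0 _ _.
by rewrite /coord cx // -val_eqE /= i0a.
Qed.

(** Follow x^a_b up to row 0 along the two diagonals of the array. *)
Lemma entry_bounds x a b : Q x -> (a + b < n)%N -> L (a + b) <= E x a b <= L b.
Proof.
move=> /gz_polytopeP Qx; elim: a b => [|a IH] b ab; first by rewrite /= lexx.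
have /andP[lo up] := Qx a b ab.
have /andP[+ _] := IH b.+1 ltac:(lia).
have /andP[_ +] := IH b ltac:(lia).
rewrite addnS addSn => ub lb.
by rewrite (le_trans lb lo) (le_trans up ub).
Qed.

(** [free a b] refers to the entry in row [a.+1] and column [b]. *)
Definition face free : set V :=
  Q `&` [set x | forall a b, (a.+1 + b < n)%N -> ~~ free a b ->
                   E x a.+1 b = L (a.+1 + b)].

Lemma eq_face free free' :
  (forall a b, (a.+1 + b < n)%N -> free a b = free' a b) ->
  face free = face free'.
Proof.
move=> ff; apply/seteqP; split=> x [Qx Fx]; split=> //= a b ab nf;
  by apply: Fx; rewrite ?ff // -?ff.
Qed.

Lemma affine_gz_entry a b : affine_form (fun x => E x a b).
Proof.
case: a => [|a]; first exact: affine_form_cst.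
rewrite /gz_entry; case: insubP => [i0 _ _|_]; last exact: affine_form_cst.
case: insubP => [k0 _ _|_]; last exact: affine_form_cst.
have [u [v uv]] := @affine_form_entry R _ (tagnat.Rank i0 k0).
by exists u, v => x; rewrite coordE uv.
Qed.

Lemma polyhedron_face free : polyhedron (face free).
Proof.
apply: polyhedronI.
  apply: polyhedron_forall => i; apply: polyhedron_forall => k.
  have lo := polyhedron_le (affine_gz_entry i k.+1) (affine_gz_entry i.+1 k).
  have up := polyhedron_le (affine_gz_entry i.+1 k) (affine_gz_entry i k).
  by apply: polyhedron_ext (polyhedronI lo up) => x /=; split=> /andP.
have pol i : polyhedron [set x | forall k : 'I_(gz_dim i), ~~ free i k ->
    E x i.+1 k <= L (i.+1 + k) /\ L (i.+1 + k) <= E x i.+1 k].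
  apply: polyhedron_forall => k; apply: polyhedron_imply.
  by apply: polyhedronI; apply: polyhedron_le;
     apply: affine_gz_entry || apply: affine_form_cst.
apply: polyhedron_ext (polyhedron_forall pol) => x /=; split.
  move=> Fx; apply: triangleP => i k nf; apply/eqP; rewrite eq_le.
  exact/andP/Fx.
by move=> Fx i k nf; rewrite Fx ?triangle_lt.
Qed.

Lemma convex_polytope_face free : convex_polytope (face free).
Proof.
split; first exact/polyhedron_mx/polyhedron_face.
exists (`|L 0| + `|L n.-1|) => x [Qx _] k.
have -> : x 0 k = E x (tagnat.sig1 k).+1 (tagnat.sig2 k).
  by rewrite gz_entryS coordE tagnat.sig2K.
have := triangle_lt (tagnat.sig2 k).
set a := (tagnat.sig1 k).+1; set b := nat_of_ord (tagnat.sig2 k) => ab.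
have /andP[lo up] := entry_bounds Qx ab.
have lo' : L n.-1 <= L (a + b) by apply: lam_le; lia.
have up' : L b <= L 0 by apply: lam_le; lia.
have := ler_norm (L 0); have := ler_norm (- L n.-1); rewrite normrN => nL n0.
have := normr_ge0 (L 0); have := normr_ge0 (L n.-1) => gL g0.
by rewrite ler_norml; apply/andP; split; lra.
Qed.

(** The bounds that the two adjacent rows impose on the entry in row [i.+1] and
    column [b].  Row [i.+2] is shorter: it imposes no lower bound on the last
    entry and no upper bound on the first one. *)
Definition lower x (i b : nat) : R :=
  if (i.+2 + b < n)%N then Num.max (E x i b.+1) (E x i.+2 b) else E x i b.+1.

Definition upper x (i b : nat) : R :=
  if b is b'.+1 then Num.min (E x i b) (E x i.+2 b') else E x i 0.

Lemma entry_lower_upper x a b :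
  Q x -> (a.+1 + b < n)%N -> lower x a b <= E x a.+1 b <= upper x a b.
Proof.
move=> /gz_polytopeP Qx ab; have /andP[lo up] := Qx a b ab.
apply/andP; split.
  rewrite /lower; case: ifP => // ab'; rewrite ge_max lo.
  by case/andP: (Qx a.+1 b ab').
rewrite /upper; case: b ab lo up => // b ab lo up; rewrite le_min up.
by case/andP: (Qx a.+1 b ltac:(lia)).
Qed.

Lemma lower_fiber i c x b : fiber i c x -> lower x i b = lower c i b.
Proof.
by move=> cx; rewrite /lower !(fiber_entry _ cx) // ?neq_ltn; lia.
Qed.

Lemma upper_fiber i c x b : fiber i c x -> upper x i b = upper c i b.
Proof.
by move=> cx; rewrite /upper; case: b => [|b];
   rewrite !(fiber_entry _ cx) // ?neq_ltn; lia.
Qed.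

Lemma le_lower1 x i b : E x i b.+1 <= lower x i b.
Proof. by rewrite /lower; case: ifP => // _; rewrite le_max lexx. Qed.

Lemma le_lower2 x i b : (i.+2 + b < n)%N -> E x i.+2 b <= lower x i b.
Proof. by move=> ib; rewrite /lower ib le_max lexx orbT. Qed.

Lemma upper_le1 x i b : upper x i b <= E x i b.
Proof. by case: b => [|b]; rewrite /upper ?lexx // ge_min lexx. Qed.

Lemma upper_le2 x i b : upper x i b.+1 <= E x i.+2 b.
Proof. by rewrite ge_min lexx orbT. Qed.

Lemma fiber_gz_polytope i c x : Q c -> fiber i c x ->
  (forall b, (i.+1 + b < n)%N -> lower c i b <= E x i.+1 b <= upper c i b) ->
  Q x.
Proof.
move=> /gz_polytopeP Qc cx bx; apply/gz_polytopeP => a b ab.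
have {}bx b' : (i.+1 + b' < n)%N ->
    lower x i b' <= E x i.+1 b' /\ E x i.+1 b' <= upper x i b'.
  by move=> /bx; rewrite (lower_fiber _ cx) (upper_fiber _ cx) => /andP.
have [ai|ai] := eqVneq a i.
  rewrite ai in ab *; have [lo up] := bx b ab.
  by rewrite (le_trans (le_lower1 _ _ _) lo) (le_trans up (upper_le1 _ _ _)).
have [ai1|ai1] := eqVneq a i.+1.
  rewrite ai1 in ab *; have [lo _] := bx b ltac:(lia).
  have [_ up] := bx b.+1 ltac:(lia).
  by rewrite (le_trans up (upper_le2 _ _ _)) (le_trans (le_lower2 _ ab) lo).
by rewrite !(fiber_entry _ cx) //; apply: Qc.
Qed.

(** Moving row [i.+1] within its bounds preserves all inequalities of the
    polytope, because each of them involves at most one entry of this row.  A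
    frozen entry keeps the value that it has at [c], which respects the
    bounds. *)
Lemma slice_face free i c : face free c ->
  slice (face free) i c =
  box (i := i) c
    (\row_k (if free i k then lower c i k else L (i.+1 + k)))
    (\row_k (if free i k then upper c i k else L (i.+1 + k))).
Proof.
move=> [Qc Fc]; apply/seteqP; split=> x.
  move=> [[Qx Fx] cx]; split=> // k; rewrite /= !mxE -gz_entryS.
  have ik := triangle_lt k.
  case: ifPn => [_|nf]; last by rewrite Fx ?lexx.
  by rewrite -(lower_fiber _ cx) -(upper_fiber _ cx) entry_lower_upper.
move=> [cx bx]; split=> //.
have {}bx : forall a b, (a.+1 + b < n)%N -> a = i ->
    if free i b then is_true (lower c i b <= E x i.+1 b <= upper c i b)
    else E x i.+1 b = L (i.+1 + b).
  apply: triangleP => a k /val_inj ai; move: k; rewrite {a}ai => k.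
  have := bx k; rewrite !mxE -gz_entryS; case: ifP => // _.
  by rewrite -eq_le => /eqP.
split.
  apply: (fiber_gz_polytope Qc cx) => b ib; have := bx i b ib erefl.
  case: ifPn => // nf ->; rewrite -(Fc _ _ ib nf).
  exact: entry_lower_upper.
move=> a b ab nf; have [ai|ai] := eqVneq a i.
  by rewrite ai in ab nf *; have := bx i b ab erefl; rewrite (negPf nf).
by rewrite (fiber_entry _ cx) //; apply: Fc.
Qed.

Lemma parapolytope_face free : parapolytope (face free).
Proof.
split; first exact: convex_polytope_face.
move=> i c [z [Fz cz]].
have sE : slice (face free) i c = slice (face free) i z.
  by rewrite /slice (fiber_eq cz).
have zz : slice (face free) i z z by [].
move: sE; rewrite (slice_face i Fz) in zz * => sE.
do 2 eexists; split; first exact: box_le zz.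
by rewrite sE /box (fiber_eq cz).
Qed.

(** With the row lambda included, the conventions sigma_0 = sigma_n = 0 become
    instances of a formula that is uniform in the row: the row lambda sums to
    0, and row n is empty. *)
Lemma sigmaE m x : (m <= n)%N -> sigma m x = \sum_(0 <= b < n - m) E x m b.
Proof.
case: m => [|m] mn.
  rewrite /sigma big_pred0 // subn0 big_mkord /=.
  by rewrite -[RHS](rmorph_sum (intmul 1)) hsum.
have [mn1|mn1] := ltnP m n.-1; last first.
  rewrite /sigma big_pred0 => [|i]; first by rewrite big_geq //; lia.
  by have := ltn_ord i; rewrite eqSS; lia.
rewrite /sigma (big_pred1 (Ordinal mn1)); last by move=> i; rewrite eqSS.
by rewrite big_mkord; apply: eq_bigr => k _; rewrite -gz_entryS.
Qed.

Lemma gz_l_fiber i c x : fiber i c x -> gz_l i c = gz_l i x.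
Proof.
move=> cx; have ltin := ltn_ord i.
rewrite /gz_l !sigmaE; [|lia..].
by congr (_ + _); apply: eq_bigr => b _;
   rewrite (fiber_entry _ cx) // neq_ltn; lia.
Qed.

(** The lower bound of column b and the upper bound of column b+1 are the
    maximum and the minimum of the same two entries. *)
Lemma sum_lower_upper i c :
  \sum_(k < gz_dim i) lower c i k + \sum_(k < gz_dim i) upper c i k = gz_l i c.
Proof.
have ltin := ltn_ord i.
rewrite /gz_l !sigmaE; [|lia..].
rewrite -!(big_mkord predT) /gz_dim.
have [-> ->] : (n - i.+1 = (n - i.+2).+1 /\ n - i = (n - i.+2).+2)%N by lia.
set e := (n - i.+2)%N.
rewrite big_nat_recr // big_nat_recl //= big_nat_recl // big_nat_recr //=.
(* The last lower bound has no neighbour in row i.+2. *)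
rewrite {2}/lower ifF; last by lia.
have -> : \sum_(0 <= b < e) lower c i b =
    \sum_(0 <= b < e) Num.max (E c i b.+1) (E c i.+2 b).
  by apply: eq_big_nat => b be; rewrite /lower ifT //; lia.
have : \sum_(0 <= b < e) Num.max (E c i b.+1) (E c i.+2 b) +
    \sum_(0 <= b < e) Num.min (E c i b.+1) (E c i.+2 b) =
    \sum_(0 <= b < e) E c i b.+1 + \sum_(0 <= b < e) E c i.+2 b.
  by rewrite -!big_split /=; apply: eq_bigr => b _; rewrite addr_max_min.
by lra.
Qed.

(** The columns before [p] are free, and so are the first [i] rows of column
    [p]. *)
Definition freed (p i a b : nat) : bool := (b < p)%N || (b == p) && (a < i)%N.

Lemma entry_tail p (i : nat) c a b : face (freed p i) c -> (a + b < n)%N ->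
  (p < b)%N || (p == b) && (i < a)%N || (a == 0) -> E c a b = L (a + b).
Proof.
case: a => // a [_ Fc] ab pb; apply: Fc => //.
by rewrite /freed; lia.
Qed.

(** Assuming only that [c] lies in the larger face, the one in which column [p]
    is already freed in row [i.+1], makes the lemma apply to both faces of a
    step: the bounds depend on the neighbouring rows only. *)
Lemma lower_tail p i c b : face (freed p i.+1) c ->
  (i.+1 + b < n)%N -> (p <= b)%N -> lower c i b = L (i.+1 + b).
Proof.
move=> Fc ib pb; rewrite /lower.
rewrite (entry_tail (b := b.+1) Fc) ?addnS //; last by lia.
case: ifP => // ib2; rewrite (entry_tail Fc) //; last by lia.
by rewrite max_l // lam_le.
Qed.

Lemma upper_tail p i c b : face (freed p i.+1) c ->
  (i.+1 + b < n)%N -> (p < b)%N -> upper c i b = L (i.+1 + b).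
Proof.
case: b => // b Fc ib pb; rewrite /upper.
rewrite !(entry_tail Fc); [|lia..].
rewrite addnS addSnnS min_r // lam_le //; lia.
Qed.

Lemma freedS p (i a b : nat) :
  freed p i.+1 a b = freed p i a b || (a == i) && (b == p).
Proof. by rewrite /freed; lia. Qed.

Lemma face_freed p i x : (i.+1 + p < n)%N ->
  face (freed p i) x <->
  face (freed p i.+1) x /\ E x i.+1 p = L (i.+1 + p).
Proof.
move=> ip; split=> [[Qx Fx]|[[Qx Fx] xp]].
  split; last by apply: Fx => //; rewrite /freed; lia.
  by split=> // a b ab; rewrite freedS negb_or => /andP[nf _]; apply: Fx.
split=> // a b ab nf.
have [/andP[/eqP -> /eqP -> //]|nab] := boolP ((a == i) && (b == p)).
by apply: Fx => //; rewrite freedS negb_or nf.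
Qed.

Definition array_point (e : nat -> nat -> R) : V :=
  \mxrow_(i < n.-1) \row_(k < gz_dim i) e i.+1 k.

Lemma array_pointE (e : nat -> nat -> R) : (forall b, e 0%N b = L b) ->
  forall a b, (a + b < n)%N -> E (array_point e) a b = e a b.
Proof.
move=> e0 [|a] b ab; first by rewrite e0.
move: a b ab; apply: triangleP => i k.
by rewrite gz_entryS coord_mxrow mxE.
Qed.

Lemma gz_pointE a b : (a + b < n)%N -> E (gz_point R lam) a b = L (a + b).
Proof. exact: (@array_pointE (fun a b => L (a + b))). Qed.

Lemma face_gz_point free : face free (gz_point R lam).
Proof.
split=> [|a b ab _]; last exact: gz_pointE.
apply/gz_polytopeP => a b ab; rewrite !gz_pointE; [|lia..].
by rewrite addnS lexx lam_le // ltnW.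
Qed.

(** The vertex a_lambda is compared with the vertex whose columns before [p] are
    constant: their entries in row [i.+1] are lambda_(i+1+k) and lambda_k. *)
Lemma face_nonconstant p i (k : 'I_(gz_dim i)) : (k < p)%N ->
  ~ in_hyperplane (face (freed p i)) k.
Proof.
move=> kp [u uE]; have ik := triangle_lt k.
pose e a b := if (b < p)%N then L b else L (a + b).
have eE := @array_pointE e ltac:(by move=> b; rewrite /e if_same).
suff Fe : face (freed p i) (array_point e).
  have := uE _ Fe; rewrite -(uE _ (face_gz_point _)) -!gz_entryS.
  rewrite eE // gz_pointE // /e kp => kk.
  by have := @lam_lt k (i.+1 + k) ltac:(lia) ik; rewrite kk ltxx.
split=> [|a b ab]; last first.
  by rewrite eE // /freed /e; case: (ltnP b p).
apply/gz_polytopeP => a b ab; rewrite !eE; [|lia..].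
rewrite /e; case: (ltnP b p) => bp; case: (ltnP b.+1 p) => bp' //; try lia;
  by apply/andP; split; apply: lam_le; lia.
Qed.

Lemma first_constant_freed p i (j : 'I_(gz_dim i)) : j = p :> nat ->
  first_constant (face (freed p i)) j.
Proof.
move=> jp; split; last by move=> k; rewrite jp; apply: face_nonconstant.
exists (L (i.+1 + p)) => x Fx; have := triangle_lt j; rewrite jp => ip.
by rewrite -gz_entryS jp; have [_ ->] := (face_freed x ip).1 Fx.
Qed.

(** * One operator *)

Section Step.
Variables (p : nat) (i : 'I_n.-1) (j : 'I_(gz_dim i)).
Hypothesis jp : j = p :> nat.

Let ip : (i.+1 + p < n)%N. Proof. by rewrite -jp triangle_lt. Qed.
Let low c : 'rV[R]_(gz_dim i) := \row_k lower c i k.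
Let upp c : 'rV[R]_(gz_dim i) := \row_k upper c i k.

Lemma slice_after c : face (freed p i.+1) c ->
  slice (face (freed p i.+1)) i c = box c (low c) (upp c).
Proof.
move=> Fc; rewrite slice_face //; congr box; apply/rowP => k;
  have ik := triangle_lt k; rewrite !mxE; case: ifPn => //;
  rewrite /freed => nf.
  by rewrite (lower_tail Fc) //; lia.
by rewrite (upper_tail Fc) //; lia.
Qed.

Lemma slice_before c : face (freed p i) c ->
  slice (face (freed p i)) i c =
  box c (low c) (set_coord (upp c) j (L (i.+1 + p))).
Proof.
move=> Fc; have Fc' := ((face_freed c ip).1 Fc).1.
rewrite slice_face //; congr box; apply/rowP => k;
  have ik := triangle_lt k; rewrite !mxE -?val_eqE /= ?jp.
  case: ifPn => // nf; rewrite (lower_tail Fc') //.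
  by rewrite /freed in nf; lia.
have [->|kp] := eqVneq (k : nat) p; first by rewrite ifF // /freed; lia.
case: ifPn => // nf; rewrite (upper_tail Fc') //.
by rewrite /freed in nf; lia.
Qed.

(** This is the equation that defines nu'_p: the upper bounds of the smaller
    face differ from [upp c] in column [p] only, and this bound is left out of
    the sum. *)
Lemma solve_upper c :
  gz_l i c - (\sum_k low c 0 k +
    \sum_(k | k != j) set_coord (upp c) j (L (i.+1 + p)) 0 k) = upper c i j.
Proof.
rewrite -sum_lower_upper (bigD1 j (F := upper c i)) //=.
have -> : \sum_k low c 0 k = \sum_(k < gz_dim i) lower c i k.
  by apply: eq_bigr => k _; rewrite mxE.
have -> : \sum_(k | k != j) set_coord (upp c) j (L (i.+1 + p)) 0 k =
    \sum_(k | k != j) upper c i k.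
  by apply: eq_bigr => k /negPf kj; rewrite !mxE kj.
by ring.
Qed.

(** Lowering the entry in row [i.+1] and column [p] to its lower bound, which is
    its frozen value, projects the larger face onto the smaller one, so the two
    faces meet the same fibers. *)
Lemma slice_before_neq0 c x : face (freed p i.+1) x -> fiber i c x ->
  slice (face (freed p i)) i c !=set0.
Proof.
move=> Fx cx.
have [y xy yE] :=
  fiber_replace x (set_coord (block x i) j (L (i.+1 + p))).
have xS : slice (face (freed p i.+1)) i x x by [].
exists y; split; last by rewrite (fiber_eq cx).
have jy : E y i.+1 p = L (i.+1 + p).
  by rewrite -jp gz_entryS /coord yE mxE eqxx jp.
apply/(face_freed _ ip); split=> //.
suff [] : slice (face (freed p i.+1)) i x y by [].
rewrite slice_after // in xS *; case: xS => _ bx; split=> // k.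
have := bx k; rewrite /= /coord yE !mxE.
case: eqP => // -> /andP[/le_trans le /le {}le].
by move: le; rewrite jp (lower_tail Fx) // lexx.
Qed.

Lemma is_divdiff_face :
  is_divdiff (@gz_l R n) i (face (freed p i)) \1_(face (freed p i.+1)).
Proof.
split; first exact: parapolytope_face.
exists j; first exact: first_constant_freed.
move=> c; split=> [S0 x cx|mu nu le_mn Sbox x cx].
  rewrite indicE memNset // => Fx.
  by have := slice_before_neq0 Fx cx; rewrite S0 => -[].
(* From here on the base point c is replaced by a point z of the face on the
   same fiber. *)
have [z [Fz cz]] : slice (face (freed p i)) i c !=set0.
  have [y cy yE] := fiber_replace c mu.
  by exists y; rewrite Sbox; split=> // k; rewrite /= /coord yE lexx le_mn.
have Fz' := ((face_freed z ip).1 Fz).1.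
have {}Sbox : box z mu nu = box z (low z) (set_coord (upp z) j (L (i.+1 + p))).
  rewrite -slice_before // /slice -(fiber_eq cz) -/(slice _ _ _) Sbox.
  by rewrite /box (fiber_eq cz).
have zS : slice (face (freed p i)) i z z by [].
rewrite slice_before // in zS.
have [-> ->] := box_inj le_mn (box_le zS) Sbox.
have le_up : L (i.+1 + p) <= upper z i j.
  have : slice (face (freed p i.+1)) i z z by [].
  rewrite slice_after // => /box_le/(_ j); rewrite !mxE jp.
  by rewrite (lower_tail Fz').
rewrite /divdiff_box (gz_l_fiber cz) solve_upper.
have -> : set_coord (upp z) j (L (i.+1 + p)) 0 j = L (i.+1 + p).
  by rewrite mxE eqxx.
have uj : upper z i j = upp z 0 j by rewrite mxE.
rewrite le_up uj set_coord_restore /box (fiber_eq cz) -/(box _ _ _).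
rewrite -slice_after //.
rewrite !indicE /slice in_setI (mem_set (_ : fiber i z x)) ?andbT //.
by rewrite -(fiber_eq cz).
Qed.

Lemma divdiff_face :
  divdiff (@gz_l R n) i (face (freed p i)) = Some (face (freed p i.+1)).
Proof.
by apply/divdiffE; split; [apply: convex_polytope_face|apply: is_divdiff_face].
Qed.

End Step.

(** * The word of operators *)

Lemma face_freed0 : face (freed 0 0) = [set gz_point R lam].
Proof.
apply/seteqP; split=> [x [_ Fx]|x -> /=]; last exact: face_gz_point.
apply: (@coord_inj R _ (@gz_dim n)) => i k; have ik := triangle_lt k.
by rewrite -!gz_entryS gz_pointE // Fx // /freed !ltn0 andbF.
Qed.

Lemma face_freed_full : face (freed n.-1 0) = Q.
Proof.
apply/seteqP; split=> [x []//|x Qx]; split=> // a b ab.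
by rewrite /freed; lia.
Qed.

Lemma filter_enum_ord_ltn m : (m <= n.-1)%N ->
  [seq i : 'I_n.-1 <- enum 'I_n.-1 | (i < m)%N] = take m (enum 'I_n.-1).
Proof.
move=> mn; apply: (inj_map val_inj).
rewrite -[LHS](filter_map val (fun k => k < m)%N).
rewrite map_take val_enum_ord (filter_iota_ltn 0) //.
by rewrite take_iota (minn_idPl mn).
Qed.

Lemma take_enum_ordS m (h : (m < n.-1)%N) :
  take m.+1 (enum 'I_n.-1) = rcons (take m (enum 'I_n.-1)) (Ordinal h).
Proof.
rewrite (take_nth (Ordinal h)) ?size_enum_ord //.
by rewrite (nth_ord_enum _ (Ordinal h)).
Qed.

Lemma divdiff_pass p m : (p + m <= n.-1)%N ->
  divdiff_prod (@gz_l R n) (rev (take m (enum 'I_n.-1))) (face (freed p 0)) =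
  Some (face (freed p m)).
Proof.
elim: m => [|m IH] pm; first by rewrite take0.
have h : (m < n.-1)%N by lia.
have hp : (p < gz_dim (Ordinal h))%N by rewrite /gz_dim /=; lia.
rewrite (take_enum_ordS h) rev_rcons /=.
rewrite -/(divdiff_prod _ _ _) IH /=; last by lia.
exact: (@divdiff_face p (Ordinal h) (Ordinal hp)).
Qed.

(** The word is read from its end, so its last [p] factors are those that have
    been applied after [p] passes. *)
Lemma divdiff_passes p : (p <= n.-1)%N ->
  divdiff_prod (@gz_l R n)
    (flatten [seq rev [seq i : 'I_n.-1 <- enum 'I_n.-1 | (i <= m)%N]
             | m : 'I_n.-1 <- drop (n.-1 - p) (enum 'I_n.-1)])
    [set gz_point R lam] = Some (face (freed p 0)).
Proof.
elim: p => [|p IH] pn.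
  by rewrite subn0 drop_oversize ?size_enum_ord //= face_freed0.
have h : (n.-1 - p.+1 < n.-1)%N by lia.
rewrite (drop_nth (Ordinal h)) ?size_enum_ord //.
rewrite (nth_ord_enum _ (Ordinal h)) /=.
have -> : (n.-1 - p.+1).+1 = (n.-1 - p)%N by lia.
rewrite (divdiff_prod_cat _ (IH _)); last by lia.
rewrite (@filter_enum_ord_ltn (n.-1 - p.+1).+1) // divdiff_pass; last by lia.
by congr Some; apply: eq_face => a b ab; rewrite /freed; lia.
Qed.

End Faces.

Theorem theorem3p4 (R : realType) (n : nat) (lam : n.-tuple int)
    (hn : (2 <= n)%N)
    (hdom : forall i j : 'I_n, (i < j)%N -> lam`_j < lam`_i)
    (hsum : \sum_(i < n) lam`_i = 0) :
  divdiff_prod (@gz_l R n) (gz_word n) [set gz_point R lam]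
  = Some (gz_polytope (R := R) lam).
Proof.
have := divdiff_passes R hdom hsum (leqnn n.-1).
by rewrite subnn drop0 face_freed_full.
Qed.
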